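(* The functions $x\mapsto Q(x)^2$ and $x\mapsto Q(\sqrt{x})^2$ are convex on $x\ge0$.
   Context: $Q(x)=\frac{1}{\sqrt{2\pi}}\int_x^\infty e^{-t^2/2}\,dt$. *)

(* Defs.v *)
From mathcomp Require Import all_boot all_order all_algebra.
From mathcomp Require Import all_classical all_reals all_analysis.

Set Implicit Arguments.
Unset Strict Implicit.
Unset Printing Implicit Defensive.

Import Order.TTheory GRing.Theory Num.Theory.
Import numFieldNormedType.Exports.

Local Open Scope classical_set_scope.
Local Open Scope ring_scope.

(** The Gaussian tail function. The integrand is integrable on every half-line,
    so the real-valued Lebesgue integral is the usual improper integral. *)
Definition gaussQ (R : realType) (x : R) : R :=
  (Num.sqrt (2 * pi))^-1 *
    \int[@lebesgue_measure R]_(t in `[x, +oo[) expR (- t ^+ 2 / 2).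

(* Main.v *)
(** On the half-line [Q] is the tail integral of a decreasing density, and minus
    the density at [z] is a subgradient of [Q] at [z].  So [Q] is convex and
    nonincreasing there, composing it with the concave square root keeps it
    convex, and so does squaring a nonnegative convex function. *)
Require Import Defs.
From mathcomp Require Import all_boot all_order all_algebra.
From mathcomp Require Import all_classical all_reals all_analysis.
From mathcomp Require Import ring.

Set Implicit Arguments.
Unset Strict Implicit.
Unset Printing Implicit Defensive.

Import Order.TTheory GRing.Theory Num.Theory.
Import numFieldNormedType.Exports.

Local Open Scope classical_set_scope.
Local Open Scope ring_scope.

(* [R^o] carries a convex-space structure of its own, syntactically different from
   that of [convex_lmodType R^o], so rewriting needs one lemma for each. *)
Lemma convR_avg (R : realType) (t : {i01 R}) (x y : R^o) :
  conv t x y = t%:num * x + (1 - t%:num) * y.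
Proof. by []. Qed.

Lemma conv_lmod_avg (R : realType) (t : {i01 R}) (x y : convex_lmodType R^o) :
  conv t x y = t%:num * x + (1 - t%:num) * y :> R.
Proof. by []. Qed.

(** The difference of the tails is the integral of [f] over [[x, y]], where [f] lies between the
    constants [f y] and [f x]. *)
Lemma Rintegral_tail_bounds (R : realType) (f : R -> R) (x y : R) :
    (@lebesgue_measure R).-integrable `[x, +oo[ (EFin \o f) ->
    {in `[x, y] &, {homo f : s t /~ s <= t}} -> x <= y ->
  let F z := \int[@lebesgue_measure R]_(t in `[z, +oo[) f t in
  (y - x) * f y <= F x - F y /\ F x - F y <= (y - x) * f x.
Proof.
move=> intf fdecr xy F.
have intfxy : lebesgue_measure.-integrable `[x, y] (EFin \o f).
  apply: (integrableS _ _ _ intf) => // t /=.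
  by rewrite !in_itv/= andbT => /andP[].
have intC (c : R) : lebesgue_measure.-integrable `[x, y] (EFin \o cst c).
  apply: continuous_compact_integrable; first exact: segment_compact.
  by apply: continuous_subspaceT => z; exact: cst_continuous.
have RC (c : R) :
    \int[lebesgue_measure]_(_ in `[x, y]) c = (y - x) * c.
  have mxy : lebesgue_measure `[x, y] = (y - x)%:E :> \bar R.
    rewrite lebesgue_measure_itv/= lte_fin.
    (* The measure formula tests [x < y], so the degenerate interval is checked apart. *)
    move: xy; rewrite le_eqVlt => /predU1P[->|->//].
    by rewrite ltxx subrr.
  by rewrite Rintegral_cst// [X in fine X]mxy mulrC.
have -> : F x - F y = \int[lebesgue_measure]_(t in `[x, y]) f t.
  (* Removing [[x, y]] from the tail at [x] leaves the open half-line beyond [y]; its missing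
     endpoint is a null set. *)
  apply/eqP; rewrite subr_eq addrC -subr_eq; apply/eqP.
  rewrite [LHS]Rintegral_itvB ?Rintegral_itv_obnd_cbnd//.
  apply: (integrableS _ _ _ intf) => // t /=.
  by rewrite !in_itv/= !andbT => /ltW; exact: le_trans.
rewrite -!RC; split.
  apply: (le_Rintegral _ (intC _) intfxy) => // t /= txy.
  by apply: fdecr => //; rewrite ?(itvP txy)// in_itv/= xy lexx.
apply: (le_Rintegral _ intfxy (intC _)) => // t /= txy.
by apply: fdecr => //; rewrite ?(itvP txy)// in_itv/= xy lexx.
Qed.

(** The gap is the variance [t (1 - t) (x - y)^2] of a two-point distribution. *)
Lemma sqr_avg_le (R : realType) (t : {i01 R}) (x y : R) :
  (t%:num * x + (1 - t%:num) * y) ^+ 2 <=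
  t%:num * x ^+ 2 + (1 - t%:num) * y ^+ 2.
Proof.
rewrite -subr_ge0.
have -> : t%:num * x ^+ 2 + (1 - t%:num) * y ^+ 2
    - (t%:num * x + (1 - t%:num) * y) ^+ 2
    = t%:num * (1 - t%:num) * (x - y) ^+ 2 by ring.
by rewrite mulr_ge0 ?sqr_ge0// mulr_ge0 ?subr_ge0.
Qed.

Lemma convex_function_sqr (R : realType) (D : set R) (f : R -> R) :
    (forall x, 0 <= f x) -> convex_function D f ->
  convex_function D (fun x => f x ^+ 2).
Proof.
move=> f0 cf t x y xD yD; have := cf t x y xD yD.
rewrite !convR_avg /= => cxy.
apply: (@le_trans _ _ ((t%:num * f x + (1 - t%:num) * f y) ^+ 2)).
  by rewrite ler_sqr ?nnegrE// (le_trans _ cxy).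
exact: sqr_avg_le.
Qed.

(** This is [sqr_avg_le] at the square roots of [x] and [y], followed by taking roots. *)
Lemma concave_sqrt (R : realType) (t : {i01 R}) (x y : R) : 0 <= x -> 0 <= y ->
  t%:num * Num.sqrt x + (1 - t%:num) * Num.sqrt y <=
  Num.sqrt (t%:num * x + (1 - t%:num) * y).
Proof.
move=> x0 y0; have t1 : 0 <= 1 - t%:num by rewrite subr_ge0.
have u0 : 0 <= t%:num * Num.sqrt x + (1 - t%:num) * Num.sqrt y.
  by rewrite addr_ge0 ?mulr_ge0 ?sqrtr_ge0.
rewrite -[leLHS](ger0_norm u0) -sqrtr_sqr ler_wsqrtr//.
by apply: le_trans (sqr_avg_le _ _ _) _; rewrite !sqr_sqrtr.
Qed.

(** Take [z] to be the average of [x] and [y] and average the subgradient inequalities from [z] to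
    each of them: the terms in [g z] cancel. *)
Lemma subgradient_convex_function (R : realType) (D : set R) (f g : R -> R) :
    convex_set D -> {in D &, forall z w, f z + (w - z) * g z <= f w} ->
  convex_function D f.
Proof.
move=> cD fg t x y xD yD; rewrite convR_avg.
have [z zE zD] : exists2 z : R, z = t%:num * x + (1 - t%:num) * y & z \in D.
  by exists (conv t x y) => //; exact: cD.
rewrite conv_lmod_avg -zE.
have t0 : 0 <= t%:num by [].
have t1 : 0 <= 1 - t%:num by rewrite subr_ge0.
apply: le_trans (lerD (ler_wpM2l t0 (fg _ _ zD xD)) (ler_wpM2l t1 (fg _ _ zD yD))).
suff -> : t%:num * (f z + (x - z) * g z) + (1 - t%:num) * (f z + (y - z) * g z)
  = f z by [].
by ring: zE.
Qed.

Lemma convex_set_itvcy (R : realType) (a : R) : convex_set (`[a, +oo[ : set R).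
Proof.
move=> x y t; rewrite !inE/= !in_itv/= !andbT conv_lmod_avg => ax ay.
have t0 : 0 <= t%:num by [].
have t1 : 0 <= 1 - t%:num by rewrite subr_ge0.
apply: le_trans (lerD (ler_wpM2l t0 ax) (ler_wpM2l t1 ay)).
by rewrite -mulrDl subrKC mul1r.
Qed.

Lemma integrable_gauss_tail (R : realType) (x : R) :
  lebesgue_measure.-integrable `[x, +oo[
    (EFin \o (fun t : R => expR (- t ^+ 2 / 2))).
Proof.
apply: (@integrableS _ _ _ _ setT) => //.
(* The integrand is the standard normal density divided by its peak value. *)
have := integrableZl measurableT (@normal_peak R 1)^-1
  (integrable_normal_pdf (0 : R) 1).
apply: eq_integrable => // t _ /=.
rewrite normal_pdfE ?oner_eq0// /normal_fun subr0 expr1n -EFinM mulKf//.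
by rewrite gt_eqF// normal_peak_gt0// oner_eq0.
Qed.

Lemma gaussQ_ge0 (R : realType) (x : R) : 0 <= gaussQ x.
Proof.
by rewrite mulr_ge0 ?invr_ge0 ?sqrtr_ge0// Rintegral_ge0// => t _; exact: expR_ge0.
Qed.

Lemma gaussQ_bounds (R : realType) (x y : R) : 0 <= x -> x <= y ->
  let g t := (Num.sqrt (2 * pi))^-1 * expR (- t ^+ 2 / 2) in
  (y - x) * g y <= gaussQ x - gaussQ y /\ gaussQ x - gaussQ y <= (y - x) * g x.
Proof.
move=> x0 xy g; rewrite -mulrBr !(mulrCA (y - x)).
have c0 : 0 <= (Num.sqrt (2 * pi : R))^-1 by rewrite invr_ge0 sqrtr_ge0.
have [|l u] := Rintegral_tail_bounds (integrable_gauss_tail x) _ xy.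
  (* The density decreases only to the right of 0, hence the use of [0 <= x]. *)
  move=> s t sxy txy ts; rewrite ler_expR ler_pM2r ?invr_gt0// lerN2.
  by rewrite ler_sqr ?nnegrE// (le_trans x0)// ?(itvP sxy) ?(itvP txy).
by split; exact: ler_wpM2l.
Qed.

Lemma gaussQ_nonincreasing (R : realType) :
  {in `[0, +oo[ &, {homo @gaussQ R : x y /~ x <= y}}.
Proof.
move=> y x; rewrite !in_itv/= !andbT => y0 x0 xy.
have [l _] := gaussQ_bounds x0 xy.
rewrite -subr_ge0; apply: le_trans l.
by rewrite !mulr_ge0 ?subr_ge0 ?invr_ge0 ?sqrtr_ge0 ?expR_ge0.
Qed.

Lemma convex_gaussQ (R : realType) :
  convex_function (`[0, +oo[ : set R) (@gaussQ R).
Proof.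
apply: (@subgradient_convex_function _ _ _
  (fun t => - ((Num.sqrt (2 * pi))^-1 * expR (- t ^+ 2 / 2)))).
  exact: convex_set_itvcy.
move=> z w; rewrite !inE/= !in_itv/= !andbT => z0 w0.
rewrite mulrN lerBlDr -lerBlDl.
(* To the right of [z] the density is at most its value at [z], so the upper bound applies; to the
   left it is at least that value, and the lower bound applies with signs reversed. *)
have [zw|/ltW wz] := leP z w; first by have [] := gaussQ_bounds z0 zw.
have [l _] := gaussQ_bounds w0 wz.
by rewrite -lerN2 opprB -mulNr opprB.
Qed.

Lemma convex_gaussQ_sqrt (R : realType) :
  convex_function (`[0, +oo[ : set R) (fun x : R => gaussQ (Num.sqrt x)).
Proof.
move=> t x y; rewrite !inE/= !in_itv/= !andbT => x0 y0.
have sqrt_in (z : R) : Num.sqrt z \in (`[0, +oo[%classic : set R).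
  by rewrite inE/= in_itv/= andbT sqrtr_ge0.
apply: le_trans (convex_gaussQ t (sqrt_in x) (sqrt_in y)).
(* As [gaussQ] reverses order, it remains to compare the arguments, which is concavity of the
   root. *)
apply: gaussQ_nonincreasing; rewrite ?conv_lmod_avg.
- by rewrite in_itv/= andbT sqrtr_ge0.
- by rewrite in_itv/= andbT addr_ge0 ?mulr_ge0 ?subr_ge0 ?sqrtr_ge0.
- exact: concave_sqrt.
Qed.

Theorem lemma5 (R : realType) :
  convex_function (`[0, +oo[ : set R) (fun x : R => gaussQ x ^+ 2) /\
  convex_function (`[0, +oo[ : set R) (fun x : R => gaussQ (Num.sqrt x) ^+ 2).
Proof.
split; apply: convex_function_sqr => [x|]; rewrite ?gaussQ_ge0//.
- exact: convex_gaussQ.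
- exact: convex_gaussQ_sqrt.
Qed.
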